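(* Let $d\ge 1$ be an integer. The origin $(0,0)\in\mathbb{R}^2$ is a double point of the weight diagram of the representation on $\mathcal{F}(d;2)$ if and only if $d=3m+1$ for some integer $m\geq 0$.
   Context: Let $W_d$ be the complex vector space of homogeneous polynomial vector fields $P\,\partial/\partial x+Q\,\partial/\partial y+R\,\partial/\partial z$ with $P,Q,R\in\mathbb{C}[x,y,z]$ homogeneous of degree $d$, modulo the subspace of the fields $G\cdot(x\,\partial/\partial x+y\,\partial/\partial y+z\,\partial/\partial z)$ with $G$ homogeneous of degree $d-1$. It has dimension $d^2+4d+3$, and $\mathcal{F}(d;2)=\mathbb{P}(W_d)$ is the space of foliations of degree $d$ on $\mathbb{CP}^2$. The group $SL_3(\mathbb{C})$ acts on $W_d$ by change of coordinates, $g\cdot X=Dg\,X(g^{-1})$. We restrict this representation to the diagonal maximal torus $T$ of $SL_3(\mathbb{C})$. The space $W_d$ is spanned by the classes of the monomial vector fields $X^{0,d}_{i,j}=x^{d-j}y^{j-i}z^{i}\,\partial/\partial x$, $X^{1,d}_{i,j}=x^{d-j}y^{j-i}z^{i}\,\partial/\partial y$, $X^{2,d}_{i,j}=x^{d-j}y^{j-i}z^{i}\,\partial/\partial z$ with $0\le i\le j\le d$, each of which is a weight vector for $T$. Put $L_1=(1,0)$, $L_2=(-\frac12,\frac{\sqrt3}{2})$, $L_3=(-\frac12,-\frac{\sqrt3}{2})$ in $\mathbb{R}^2$. The weight of $X^{l,d}_{i,j}$ corresponds to the point $-L_1(d-j-i)-L_2(j-2i)+L_{l+1}\in\mathbb{R}^2$,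 for $l=0,1,2$. The set of all these points is the weight diagram of the representation. A point of the weight diagram is called double if there are two weights of the representation corresponding to it, where weights are counted with multiplicity in the decomposition of the $(d^2+4d+3)$-dimensional space $W_d$ into one-dimensional $T$-subrepresentations (that is, the corresponding weight space in $W_d$ has dimension two). *)

(* Defs.v *)
From HB Require Import structures.
From mathcomp Require Import all_boot all_order all_algebra.
From mathcomp Require Import generic_quotient ring_quotient.
From mathcomp.real_closed Require Import complex.
From mathcomp.multinomials Require Import mpoly.
From mathcomp Require Import reals.
From mathcomp Require Import ring lra.

Set Implicit Arguments.
Unset Strict Implicit.
Unset Printing Implicit Defensive.

Import Order.TTheory GRing.Theory Num.Theory.
Local Open Scope ring_scope.
Local Open Scope quotient_scope.

Section QuotientSpace.
Variables (K : fieldType) (V : vectType K) (U : {vspace V}).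

(* The quotient V / U; Quotient.quot only provides the additive structure. *)
Definition vquot : Type := Quotient.quot (pred_of_vspace U).

HB.instance Definition _ := GRing.Zmodule.on vquot.
HB.instance Definition _ := EqQuotient.on vquot.

Definition vproj (v : V) : vquot := \pi_(Quotient.quot (pred_of_vspace U)) v.
Definition vrepr (w : vquot) : V := repr (w : Quotient.quot (pred_of_vspace U)).

Lemma vreprK : cancel vrepr vproj.
Proof. by move=> w; exact: reprK. Qed.

Lemma vproj_eq x y : (vproj x == vproj y) = (x - y \in U).
Proof. by rewrite /vproj -Quotient.idealrBE. Qed.

Lemma vprojB : zmod_morphism vproj.
Proof. by move=> x y; rewrite /vproj !piE. Qed.

HB.instance Definition _ := GRing.isZmodMorphism.Build V vquot vproj vprojB.

Definition vscale (a : K) (w : vquot) : vquot := vproj (a *: vrepr w).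

Lemma vscale_proj a x : vscale a (vproj x) = vproj (a *: x).
Proof.
apply/eqP; rewrite vproj_eq -scalerBr memvZ // -vproj_eq.
by rewrite vreprK.
Qed.

Fact vscaleA a b w : vscale a (vscale b w) = vscale (a * b) w.
Proof. by rewrite -[w]vreprK !vscale_proj scalerA. Qed.
Fact vscale1 : left_id 1 vscale.
Proof. by move=> w; rewrite -[w]vreprK vscale_proj scale1r. Qed.
Fact vscaleDr : right_distributive vscale +%R.
Proof.
move=> a w1 w2; rewrite -[w1]vreprK -[w2]vreprK -raddfD !vscale_proj.
by rewrite -raddfD scalerDr.
Qed.
Fact vscaleDl w : {morph vscale^~ w : a b / a + b}.
Proof.
by move=> a b; rewrite -[w]vreprK !vscale_proj scalerDl raddfD.
Qed.

HB.instance Definition _ :=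
  GRing.Zmodule_isLmodule.Build K vquot vscaleA vscale1 vscaleDr vscaleDl.

Lemma vproj_linear : linear vproj.
Proof. by move=> a x y; rewrite raddfD /= -vscale_proj. Qed.
HB.instance Definition _ := GRing.isLinear.Build K V vquot _ vproj vproj_linear.

Fact vquot_vect_iso : Vector.axiom (\dim (U^C)%VS) vquot.
Proof.
pose f (w : vquot) : subvs_of (U^C)%VS := vsproj _ (daddv_pi (U^C) U (vrepr w)).
have dUC : (U^C :&: U = 0)%VS by rewrite capvC capv_compl.
have dUC' : (U :&: U^C = 0)%VS by rewrite capv_compl.
have sUC x : daddv_pi (U^C) U x + daddv_pi U (U^C) x = x.
  by rewrite daddv_pi_add // addvC addv_complf memvf.
have kill x : x \in U -> daddv_pi (U^C) U x = 0.
  move=> xU; have := sUC x; rewrite [X in _ + X]daddv_pi_id //.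
  by move/(canRL (addrK _)); rewrite subrr.
have fpi x : f (vproj x) = vsproj _ (daddv_pi (U^C) U x).
  rewrite /f; congr vsproj; apply/eqP; rewrite -subr_eq0 -linearB /=.
  by rewrite kill // -vproj_eq vreprK.
have f_lin : linear f.
  move=> a w1 w2; rewrite -[w1]vreprK -[w2]vreprK -linearP !fpi.
  by rewrite !linearP.
have f_bij : bijective f.
  exists (fun u => vproj (vsval u)) => [w|u].
    rewrite -{1}[w]vreprK fpi vsprojK ?memv_pi //.
    rewrite -[RHS]vreprK; apply/eqP; rewrite vproj_eq.
    rewrite -[X in _ - X]sUC opprD addrA subrr add0r memvN.
    exact: memv_pi.
  by rewrite fpi daddv_pi_id ?subvsP // vsvalK.
pose fl : {linear vquot -> subvs_of (U^C)%VS} :=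
  HB.pack f (GRing.isLinear.Build _ _ _ _ f f_lin).
have [g gl gb] : Vector.axiom (\dim (U^C)%VS) (subvs_of (U^C)%VS) by exact: subvs_vect_iso.
exists (g \o f); last exact: bij_comp.
by move=> a x y /=; rewrite f_lin gl.
Qed.

HB.instance Definition _ := Lmodule_hasFinDim.Build K vquot vquot_vect_iso.

End QuotientSpace.


Section Foliations.
Variable R : realType.
Local Notation C := (complex R).

Section Spaces.
Variable d : nat.

(* X k is the coefficient of the derivation along the k-th coordinate. *)
Definition vfield := {ffun 'I_3 -> dhomog 3 C d}.
HB.instance Definition _ := Vector.on vfield.

End Spaces.

Section Radial.
Variable e : nat.

Fact radial_homog (G : dhomog 3 C e) (k : 'I_3) :
  ('X_k * val G : {mpoly C[3]}) \is e.+1.-homog.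
Proof.
rewrite -[e.+1]add1n; apply: dhomogM; last exact: dhomog_is_dhomog.
by rewrite dhomogX /= mdeg1.
Qed.

(* G * (x d/dx + y d/dy + z d/dz) *)
Definition radial (G : dhomog 3 C e) : vfield e.+1 :=
  [ffun k => DHomog (radial_homog G k)].

Fact radial_linear : linear radial.
Proof.
move=> a G H; apply/ffunP => k; rewrite !ffunE; apply: val_inj => /=.
by rewrite mulrDr scalerAr.
Qed.

HB.instance Definition _ :=
  GRing.isLinear.Build C (dhomog 3 C e) (vfield e.+1) _ radial radial_linear.

End Radial.

(* No nonzero homogeneous polynomial has degree -1. *)
Definition radial_space (d : nat) : {vspace vfield d} :=
  match d with
  | 0%N => 0%VS
  | e.+1 => limg (linfun (@radial e))
  end.

Definition W (d : nat) := vquot (radial_space d).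
HB.instance Definition _ d := Vector.on (W d).

Definition vclass d (X : vfield d) : W d := vproj (radial_space d) X.

(* The components of the linear map x |-> A x, as linear forms. *)
Definition linear_forms (A : 'M[C]_3) : 3.-tuple {mpoly C[3]} :=
  [tuple \sum_(j < 3) A i j *: 'X_j | i < 3].

Fact linear_subst_homog d (p : dhomog 3 C d) (A : 'M[C]_3) :
  (val p \mPo linear_forms A) \is d.-homog.
Proof.
rewrite comp_mpolyE big_seq; apply: rpred_sum => m m_p; apply: rpredZ.
have /= <- := dhomog_mf (dhomog_is_dhomog p) m_p.
rewrite mdegE; elim/big_rec2: _ => [|k n q _ q_n]; first exact: dhomog1.
apply: dhomogM q_n; rewrite -[X in X.-homog]mul1n; apply: dhomogMn.
rewrite tnth_mktuple; apply: rpred_sum => j _; apply: rpredZ.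
by rewrite dhomogX /= mdeg1.
Qed.

Definition linear_subst d (A : 'M[C]_3) (p : dhomog 3 C d) : dhomog 3 C d :=
  DHomog (linear_subst_homog p A).

(* g . X = Dg X(g^-1), with Dg = g because g is linear. *)
Definition act_vfield d (g : 'M[C]_3) (X : vfield d) : vfield d :=
  [ffun k => \sum_(l < 3) g k l *: linear_subst (invmx g) (X l)].

(* Independent of the representative when g is in SL3: see act_vclass. *)
Definition act d (g : 'M[C]_3) (w : W d) : W d :=
  vclass (act_vfield g (vrepr w)).

Definition SL3 : pred 'M[C]_3 := [pred g | \det g == 1].
Definition torus : pred 'M[C]_3 := [pred t | (t \in SL3) && is_diag_mx t].

Lemma SL3_unitmx g : g \in SL3 -> g \in unitmx.
Proof. by rewrite inE unitmxE => /eqP ->; exact: unitr1. Qed.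

Lemma linear_subst_linear d A : linear (@linear_subst d A).
Proof. by move=> a p q; apply: val_inj; rewrite /= linearP. Qed.
HB.instance Definition _ d A := GRing.isLinear.Build C (dhomog 3 C d)
  (dhomog 3 C d) _ (@linear_subst d A) (@linear_subst_linear d A).

Lemma act_vfield_linear d g : linear (@act_vfield d g).
Proof.
move=> a X Y; apply/ffunP => k; rewrite !ffunE scaler_sumr -big_split /=.
apply: eq_bigr => l _; rewrite !ffunE linearP /= scalerDr.
by rewrite !scalerA mulrC.
Qed.
HB.instance Definition _ d g := GRing.isLinear.Build C (vfield d) (vfield d) _
  (@act_vfield d g) (@act_vfield_linear d g).

Lemma act_radial e g (G : dhomog 3 C e) : g \in SL3 ->
  act_vfield g (radial G) = radial (linear_subst (invmx g) G).
Proof.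
move=> /SL3_unitmx gU; apply/ffunP => k; rewrite !ffunE; apply: val_inj => /=.
rewrite raddf_sum /= -[X in _ = X * _](_ : \sum_(l < 3)
  g k l *: (\sum_(j < 3) invmx g l j *: 'X_j) = 'X_k :> {mpoly C[3]}).
  rewrite mulr_suml; apply: eq_bigr => l _; rewrite ffunE /= -scalerAl.
  by rewrite rmorphM /= comp_mpolyXU -tnth_nth tnth_mktuple.
under eq_bigr => l _ do rewrite scaler_sumr.
rewrite exchange_big /=.
transitivity (\sum_(j < 3) (g *m invmx g) k j *: ('X_j : {mpoly C[3]})).
  apply: eq_bigr => j _; rewrite mxE scaler_suml.
  by apply: eq_bigr => l _; rewrite scalerA.
rewrite mulmxV // (bigD1 k) //= mxE eqxx scale1r big1 ?addr0 // => j jk.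
by rewrite mxE eq_sym (negPf jk) scale0r.
Qed.

Lemma act_radial_space d g (X : vfield d) : g \in SL3 ->
  X \in radial_space d -> act_vfield g X \in radial_space d.
Proof.
case: d X => [|e] X gS /=; first by rewrite !memv0 => /eqP ->; rewrite linear0.
move=> /memv_imgP [G _ ->]; rewrite lfunE /= act_radial //.
by apply/memv_imgP; exists (linear_subst (invmx g) G); rewrite ?memvf ?lfunE.
Qed.

Lemma act_vclass d (g : 'M[C]_3) (X : vfield d) :
  g \in SL3 -> act g (vclass X) = vclass (act_vfield g X).
Proof.
move=> gS; apply/eqP; rewrite vproj_eq -linearB act_radial_space //.
by rewrite -vproj_eq vreprK.
Qed.

Definition character (a : 'I_3 -> int) (t : 'M[C]_3) : C :=
  \prod_(k < 3) t k k ^ a k.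

(* Every character of the torus has the form character a; the family a is
   unique up to adding a constant. *)
Definition is_weight_space d (a : 'I_3 -> int) (U : {vspace W d}) : Prop :=
  forall w : W d,
    w \in U <-> (forall t, t \in torus -> act t w = character a t *: w).

(* L_1, L_2, L_3, indexed from 0. *)
Definition L (k : 'I_3) : R * R :=
  match val k with
  | 0%N => (1, 0)
  | 1%N => (- 2^-1, Num.sqrt 3 / 2)
  | _ => (- 2^-1, - (Num.sqrt 3 / 2))
  end.

(* The point of the plane corresponding to the weight character a; by
   weight_point_inj distinct weights have distinct points, and by act_monomial
   and weight_point_monomial the weight of X^{l,d}_{i,j} has the point
   monomial_point d l i j. *)
Definition weight_point (a : 'I_3 -> int) : R * R := \sum_(k < 3) L k *~ a k.

Definition monomial_mnm (d i j : nat) : 'X_{1..3} :=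
  [multinom [:: (d - j)%N; (j - i)%N; i]].

(* X^{l,d}_{i,j}, for i <= j <= d (otherwise the monomial is not homogeneous of
   degree d). *)
Definition monomial_vfield d (l : 'I_3) (i j : nat) : vfield d :=
  [ffun k => if k == l then indhomog d 'X_[C, monomial_mnm d i j] else 0].

Definition monomial_point (d : nat) (l : 'I_3) (i j : nat) : R * R :=
  - (L 0 *~ (d%:Z - j%:Z - i%:Z)) - L 1 *~ (j%:Z - 2 * i%:Z) + L l.

Definition monomial_weight (l : 'I_3) (i j d : nat) (k : 'I_3) : int :=
  (k == l)%:Z - (monomial_mnm d i j k)%:Z.

Lemma torus_neq0 t k : t \in torus -> t k k != 0.
Proof.
case/andP => /[!inE] /eqP dt1 /is_diag_mxP td.
apply/eqP => tk0; move/eqP: dt1; rewrite (_ : \det t = 0) 1?eq_sym ?oner_eq0 //.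
rewrite (expand_det_row _ k) big1 // => j _.
have [<-|jk] := eqVneq k j; first by rewrite tk0 mul0r.
by rewrite td ?mul0r.
Qed.

Lemma torus_offdiag t k j : t \in torus -> k != j -> t k j = 0.
Proof. by case/andP => _ /is_diag_mxP td kj; apply: td. Qed.

Lemma torus_invmx t k j : t \in torus ->
  invmx t k j = if k == j then (t k k)^-1 else 0.
Proof.
move=> tT; have tU : t \in unitmx by case/andP: tT => /SL3_unitmx.
pose s := \matrix_(i, j) if i == j then (t i i)^-1 else 0 : C.
rewrite (_ : invmx t = s) ?mxE //.
apply: (can_inj (mulKmx tU)); rewrite mulmxV //; apply/matrixP => i i'.
rewrite !mxE (bigD1 i) //= big1 ?addr0.
  by rewrite mxE; case: eqP => _; rewrite ?mulr0 // mulfV // torus_neq0.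
by move=> l li; rewrite torus_offdiag ?mul0r // eq_sym.
Qed.

Lemma act_monomial d l i j t : (i <= j <= d)%N -> t \in torus ->
  act t (vclass (monomial_vfield d l i j)) =
  character (monomial_weight l i j d) t *: vclass (monomial_vfield d l i j).
Proof.
case/andP=> le_ij le_jd tT; have [tS _] := andP tT.
have mH : ('X_[C, monomial_mnm d i j] : {mpoly C[3]}) \is d.-homog.
  rewrite dhomogX /= mdegE !big_ord_recl big_ord0 !multinomE /= !(tnth_nth 0%N) /=.
  by rewrite addn0 subnK // subnK.
rewrite act_vclass // -linearZ; congr vclass.
apply/ffunP => k; rewrite !ffunE (bigD1 k) //= big1 ?addr0; last first.
  by move=> l' l'k; rewrite torus_offdiag ?scale0r // eq_sym.
rewrite ffunE; case: eqVneq => [->{k}|_]; last by rewrite linear0 !scaler0.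
apply: val_inj; rewrite /= /indhomog insubdK //.
rewrite comp_mpolyX.
under eq_bigr => k _.
  rewrite tnth_mktuple (bigD1 k) //= big1 ?addr0; last first.
    by move=> k' kk'; rewrite torus_invmx // eq_sym (negPf kk') scale0r.
  rewrite torus_invmx // eqxx exprZn.
  over.
rewrite scaler_prod scalerA /character -mpolyXE_id; congr (_ *: _).
under [RHS]eq_bigr => k _ do rewrite /monomial_weight expfzDr ?torus_neq0 //.
rewrite big_split /=; congr (_ * _).
  rewrite (bigD1 l) //= eqxx big1 ?mulr1 // => k kl.
  by rewrite (negPf kl).
by apply: eq_bigr => k _; rewrite exprVn exprnN.
Qed.

Lemma L_sum : L 0 + L 1 + L ord_max = 0.
Proof. by rewrite /L /=; congr (_, _); rewrite /=; field. Qed.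

Lemma weight_pointE a :
  weight_point a = L 0 *~ (a 0 - a ord_max) + L 1 *~ (a 1 - a ord_max).
Proof.
have /eqP := L_sum; rewrite addrC addr_eq0 => /eqP L2.
rewrite /weight_point !big_ord_recl big_ord0 addr0.
rewrite (_ : lift ord0 ord0 = 1); last exact: val_inj.
rewrite (_ : lift ord0 (lift ord0 ord0) = ord_max); last exact: val_inj.
rewrite L2 mulNrz mulrzDl !mulrzBr opprD addrA.
by rewrite addrACA addrA.
Qed.

Lemma weight_point_monomial d l i j : (i <= j <= d)%N ->
  weight_point (monomial_weight l i j d) = monomial_point d l i j.
Proof.
case/andP=> le_ij le_jd; rewrite weight_pointE /monomial_weight.
rewrite !multinomE !(tnth_nth 0%N) /= -!subzn //.
have -> : monomial_point d l i j =
    L 0 *~ (((0 : 'I_3) == l)%:Z - ((ord_max : 'I_3) == l)%:Z - (d%:Z - j%:Z - i%:Z)) +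
    L 1 *~ (((1 : 'I_3) == l)%:Z - ((ord_max : 'I_3) == l)%:Z - (j%:Z - 2 * i%:Z)).
  rewrite /monomial_point [X in _ + X](_ : _ =
      L 0 *~ (((0 : 'I_3) == l)%:Z - ((ord_max : 'I_3) == l)%:Z) +
      L 1 *~ (((1 : 'I_3) == l)%:Z - ((ord_max : 'I_3) == l)%:Z)).
    by rewrite !(mulrzBr _ (_ - _)) addrC addrACA.
  have /eqP := L_sum; rewrite addrC addr_eq0 => /eqP L2.
  case: l => [[|[|[|//]]] lt_l].
  - by rewrite (_ : Ordinal lt_l = 0) /= ?addr0 //; exact: val_inj.
  - by rewrite (_ : Ordinal lt_l = 1) /= ?add0r //; exact: val_inj.
  - rewrite (_ : Ordinal lt_l = ord_max) /=; last exact: val_inj.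
    by rewrite L2 opprD.
by congr (_ *~ _ + _ *~ _); ring.
Qed.

Lemma weight_point_inj a b : weight_point a = weight_point b ->
  {in torus, character a =1 character b}.
Proof.
move=> eq_ab t tT; pose c := a ord_max - b ord_max.
have coord m n : L 0 *~ m + L 1 *~ n =
    (m%:~R - n%:~R / 2, n%:~R * (Num.sqrt 3 / 2)) :> R * R.
  rewrite /L /=.
  have pz (x y : R) k : (x, y) *~ k = (x *~ k, y *~ k).
    by rewrite [LHS]surjective_pairing !raddfMz.
  rewrite !pz; congr (_, _); rewrite /= ?mul0rz ?add0r.
    by rewrite mulNrz -[2^-1 *~ n]mulrzl.
  by rewrite -mulrzl.
move: eq_ab; rewrite !weight_pointE !coord => -[eq1 eq2].
have s0 : Num.sqrt 3 / 2 != 0 :> R.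
  by rewrite mulf_neq0 ?invr_eq0 ?pnatr_eq0 // sqrtr_eq0 -ltNge ltr0n.
have eqn := mulIf s0 eq2.
move: eq1; rewrite eqn => /addIr /intr_inj eq0; move/intr_inj: eqn => eq1.
have ab k : a k = b k + c.
  case: k => [[|[|[|//]]] lt_k].
  - rewrite (_ : Ordinal lt_k = 0) /c; last exact: val_inj.
    by rewrite -[LHS](subrK (a ord_max)) eq0; ring.
  - rewrite (_ : Ordinal lt_k = 1) /c; last exact: val_inj.
    by rewrite -[LHS](subrK (a ord_max)) eq1; ring.
  - rewrite (_ : Ordinal lt_k = ord_max) /c; last exact: val_inj.
    by rewrite addrC subrK.
rewrite /character; under eq_bigr => k _ do rewrite ab expfzDr ?torus_neq0 //.
rewrite big_split /= -[RHS]mulr1; congr (_ * _).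
transitivity ((\det t) ^ c); last first.
  by case/andP: tT => /[!inE] /eqP -> _; rewrite exp1rz.
rewrite det_trig; last by apply: is_diag_mx_is_trig; case/andP: tT.
apply: esym; apply: (big_morph (fun x : C => x ^ c)); last exact: exp1rz.
by move=> x y /=; rewrite expfzMl.
Qed.

Definition weight_diagram (d : nat) (p : R * R) : Prop :=
  exists l i j, (i <= j <= d)%N /\ p = monomial_point d l i j.

(* Double: the corresponding weight space of W d has dimension two. *)
Definition double_point (d : nat) (p : R * R) : Prop :=
  weight_diagram d p /\
  exists (a : 'I_3 -> int) (U : {vspace W d}),
    [/\ weight_point a = p, is_weight_space a U & \dim U = 2%N].

End Foliations.

(* Main.v *)
Require Import Defs.
From HB Require Import structures.
From mathcomp Require Import all_boot all_order all_algebra.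
From mathcomp.real_closed Require Import complex.
From mathcomp.multinomials Require Import mpoly.
From mathcomp Require Import reals.
From mathcomp Require Import zify.

(** The exponents of a monomial vector field of degree d, seen as a character
    of the diagonal matrices of GL3, add up to 1 - d.  Its weight restricted to
    the torus of SL3 sits at the origin exactly when these three exponents are
    equal ([weight_point_eq0P]), so the origin belongs to the diagram only if
    3 divides d - 1 ([monomial_weight_constP]).

    Conversely, let d = 3m + 1.  The monomial fields with three equal exponents
    are x_l (xyz)^m d/dx_l for l = 0, 1, 2.  Their sum is radial, and it is the
    only relation among their classes: a radial field with a zero component is
    zero ([radial_space_eq0]), so the classes for l = 0 and l = 1 are
    independent ([balanced_classes_free]).  They span a plane of torus
    invariants, and this plane is the whole weight space, because W d is
    spanned by classes of monomials, which are joint eigenvectors of the torus,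
    and a joint eigenvector is a combination of the spanning eigenvectors that
    have its own weight ([joint_eigenspace_sub]).  The latter needs torus
    elements which separate a non-constant family of exponents from the trivial
    character: the matrices with entries 2 and 1/2 in two places and 1 in the
    third ([cochar_mx]). *)

Set Implicit Arguments.
Unset Strict Implicit.
Unset Printing Implicit Defensive.

Import Order.TTheory GRing.Theory Num.Theory.
Local Open Scope ring_scope.

(** * Joint eigenvectors *)

(** Induction on X.  A spanning vector v in U can be subtracted from w.  If
    some f t separates the eigenvalue lam of v from mu, then f t - lam kills
    the component along v and multiplies w by mu - lam, which is invertible,
    so that w is already in the span of the other vectors. *)
Lemma joint_eigenspace_sub (K : fieldType) (V : vectType K) (A : Type)
    (f : A -> {linear V -> V}) (mu : A -> K) (U : {vspace V})
    (X : seq V) (w : V) :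
    (forall t u, u \in U -> f t u = mu t *: u) ->
    (forall v, v \in X -> exists2 lam : A -> K,
       forall t, f t v = lam t *: v & v \in U \/ exists t, lam t != mu t) ->
    w \in <<X>>%VS -> (forall t, f t w = mu t *: w) -> w \in U.
Proof.
move=> fU; elim: X w => [|v X IH] w Xs.
  by rewrite span_nil memv0 => /eqP->; rewrite mem0v.
have [lam flam vU] := Xs v (mem_head _ _).
have {}Xs u (uX : u \in X) := Xs u (mem_behead (s := v :: X) uX).
rewrite span_cons => /memv_addP[_ /vlineP[k ->] [w' w'X def_w]] fw.
case: vU => [vU|[t lam_mu]].
  rewrite def_w; apply/rpredD/IH => //; first exact: memvZ.
  have -> : w' = (- k) *: v + w by rewrite def_w addrA scaleNr addNr add0r.
  by move=> t; rewrite linearP fw // fU // scalerDr !scalerA mulrC.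
have fX : f t w' \in <<X>>%VS.
  rewrite (coord_span (X := in_tuple X) w'X) linear_sum.
  apply: memv_suml => i _; have Xi : X`_i \in X by apply: mem_nth.
  have [nu fnu _] := Xs _ Xi.
  by rewrite linearZ /= fnu !memvZ // memv_span.
apply: IH => //.
have d0 : mu t - lam t != 0 by rewrite subr_eq0 eq_sym.
have -> : w = (mu t - lam t)^-1 *: (f t w' - lam t *: w').
  apply: (scalerI d0); rewrite scalerA divff // scale1r scalerBl -fw def_w.
  rewrite linearD linearZ /= flam scalerDr !scalerA [k * _]mulrC.
  by rewrite opprD addrACA subrr add0r.
by rewrite memvZ // memvB // memvZ.
Qed.

(** * Monomials in three variables *)

Lemma mdeg3 (m : 'X_{1..3}) : mdeg m = (m 0%R + (m 1%R + m ord_max))%N.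
Proof.
rewrite mdegE !big_ord_recl big_ord0 addn0.
by congr (m _ + (m _ + m _))%N; apply: val_inj.
Qed.

Lemma mnm3P (m1 m2 : 'X_{1..3}) :
  m1 0 = m2 0 -> m1 1 = m2 1 -> m1 ord_max = m2 ord_max -> m1 = m2.
Proof.
move=> e0 e1 e2; apply/mnmP; case=> [[|[|[|//]]] lt_k].
- by rewrite (_ : Ordinal lt_k = 0) //; apply: val_inj.
- by rewrite (_ : Ordinal lt_k = 1) //; apply: val_inj.
- by rewrite (_ : Ordinal lt_k = ord_max) //; apply: val_inj.
Qed.

Lemma monomial_mnm_exp d (m : 'X_{1..3}) : mdeg m = d ->
  monomial_mnm d (m ord_max) (m 1%R + m ord_max) = m.
Proof.
move=> <-; rewrite mdeg3.
by apply: mnm3P; rewrite multinomE (tnth_nth 0%N) /=; lia.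
Qed.

Definition xyz_mnm m : 'X_{1..3} := [multinom m | _ < 3].

Lemma xyz_mnmE m k : xyz_mnm m k = m.
Proof. by rewrite mnmE. Qed.

Lemma mdeg_xyz m : mdeg (xyz_mnm m) = (3 * m)%N.
Proof. by rewrite mdeg3 !xyz_mnmE; lia. Qed.

Section Foliations.
Variable R : realType.
Local Notation C := (complex R).

Lemma val_indhomogX d (m : 'X_{1..3}) : mdeg m = d ->
  val (indhomog d 'X_[C, m]) = 'X_[m].
Proof. by move=> dm; rewrite /indhomog insubdK // dhomogX /= dm. Qed.

Lemma mpolyX_neq0 (m : 'X_{1..3}) : 'X_[m] != 0 :> {mpoly C[3]}.
Proof. by rewrite -msupp_eq0 msuppX. Qed.

(** * Classes of vector fields and the action of the torus *)

Lemma vclass_linear d : linear (@vclass R d).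
Proof. exact: linearP. Qed.
HB.instance Definition _ d := GRing.isLinear.Build C (vfield R d) (W R d) _
  (@vclass R d) (@vclass_linear d).

Lemma vclass_eq0 d (X : vfield R d) :
  (vclass X == 0) = (X \in radial_space R d).
Proof. by rewrite -[X in X \in _]subr0 -vproj_eq linear0. Qed.

(** A radial field is G times (x, y, z), so each of its components determines
    the polynomial G. *)
Lemma radial_space_eq0 d (X : vfield R d) k :
  X \in radial_space R d -> X k = 0 -> X = 0.
Proof.
case: d X => [|e] X /=; first by rewrite memv0 => /eqP.
move=> /memv_imgP[G _ ->]; rewrite lfunE /= ffunE => /(congr1 val) /= /eqP.
rewrite mulf_eq0 => /orP[|/eqP G0].
  by rewrite (negPf (mpolyX_neq0 _)).
by apply/ffunP=> l; apply: val_inj; rewrite !ffunE /= G0 mulr0.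
Qed.

Lemma act_linear d (t : 'M[C]_3) : t \in @torus R -> linear (@act R d t).
Proof.
case/andP=> tS _ a w1 w2; rewrite -[w1]vreprK -[w2]vreprK -linearP.
have vE X : vproj (radial_space R d) X = vclass X by [].
by rewrite !vE !act_vclass // -!vE -linearP /= linearP.
Qed.

(** Indexing by the subtype makes every member of the family a linear map: for
    a singular matrix, [act] depends on the choice of representatives. *)
Definition torus_act d (t : {t : 'M[C]_3 | t \in @torus R}) (w : W R d) : W R d :=
  act (val t) w.
HB.instance Definition _ d t := GRing.isLinear.Build C (W R d) (W R d) _
  (@torus_act d t) (act_linear (valP t)).

Lemma torus_act_monomial d l i j t : (i <= j <= d)%N ->
  torus_act t (vclass (monomial_vfield R d l i j)) =
  character (monomial_weight l i j d) (val t) *: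
    vclass (monomial_vfield R d l i j).
Proof. by move=> le_ijd; apply: act_monomial; rewrite ?(valP t). Qed.

Definition monomial_classes d : seq (W R d) :=
  [seq vclass (monomial_vfield R d x.1.1 x.1.2 x.2)
     | x : 'I_3 * 'I_d.+1 * 'I_d.+1
       in [pred x : 'I_3 * 'I_d.+1 * 'I_d.+1 | (x.1.2 <= x.2)%N]].

Lemma monomial_class_mem d l i j : (i <= j <= d)%N ->
  vclass (monomial_vfield R d l i j) \in monomial_classes d.
Proof.
case/andP=> le_ij le_jd; apply/imageP.
have lt_id : (i < d.+1)%N by lia.
by exists (l, Ordinal lt_id, Ordinal (le_jd : (j < d.+1)%N)).
Qed.

Lemma monomial_classes_span d (w : W R d) : w \in <<monomial_classes d>>%VS.
Proof.
rewrite -[w]vreprK; set X : vfield R d := vrepr w.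
pose mono l (m : 'X_{1..3}) :=
  monomial_vfield R d l (m ord_max) (m 1%R + m ord_max).
have -> : X = \sum_l \sum_(m <- msupp (val (X l))) (val (X l))@_m *: mono l m.
  apply/ffunP => k; rewrite sum_ffunE.
  rewrite (bigD1 k) // [X in _ = _ X]big1 => [|l /= lk]; last first.
    rewrite sum_ffunE big1 // => m _.
    by rewrite !ffunE eq_sym (negPf lk) scaler0.
  rewrite /= addr0; apply: val_inj.
  rewrite sum_ffunE raddf_sum /= {1}[val (X k)]mpolyE.
  apply: eq_big_seq => m mX; have dm := dhomog_mf (dhomog_is_dhomog (X k)) mX.
  by rewrite !ffunE eqxx linearZ /= monomial_mnm_exp // val_indhomogX.
rewrite linear_sum; apply: memv_suml => l _; rewrite linear_sum big_seq.
apply: memv_suml => m mX; rewrite linearZ /=; apply/memvZ/memv_span.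
have /= dm := dhomog_mf (dhomog_is_dhomog (X l)) mX.
by apply: monomial_class_mem; rewrite -dm mdeg3; lia.
Qed.

(** * Weights at the origin *)

Lemma sumr_mul_deltaB (e : 'I_3 -> int) k l :
  \sum_i ((i == k)%:Z - (i == l)%:Z) * e i = e k - e l.
Proof.
have delta h : \sum_i (i == h)%:Z * e i = e h.
  rewrite (bigD1 h) //= eqxx mul1r big1 ?addr0 // => i ih.
  by rewrite (negPf ih) mul0r.
by under eq_bigr => i _ do rewrite mulrBl; rewrite sumrB !delta.
Qed.

(** The value at 2 of the one-parameter subgroup of the torus attached to the
    coroot e_k - e_l. *)
Definition cochar_mx (k l : 'I_3) : 'M[C]_3 :=
  diag_mx (\row_i 2 ^ ((i == k)%:Z - (i == l)%:Z)).

Lemma character_cochar (a : 'I_3 -> int) k l :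
  character a (cochar_mx k l) = 2 ^ (a k - a l).
Proof.
rewrite -sumr_mul_deltaB /character.
rewrite (big_morph (fun n : int => (2 : C) ^ n) (id1 := 1) (op1 := *%R)) //.
  by apply: eq_bigr => i _; rewrite !mxE eqxx mulr1n exprz_exp.
by move=> m n /=; rewrite expfzDr ?pnatr_eq0.
Qed.

Lemma cochar_torus k l : cochar_mx k l \in @torus R.
Proof.
rewrite inE /= diag_mx_is_diag andbT inE /= det_diag.
(* The determinant is the character with all exponents equal to 1. *)
have ch1 : character (fun=> 1) (cochar_mx k l) = 1 by rewrite character_cochar.
by apply/eqP; rewrite -[RHS]ch1; apply: eq_bigr => i _; rewrite !mxE eqxx mulr1n expr1z.
Qed.

Lemma expz2_eq1 (n : int) : ((2 : C) ^ n == 1) = (n == 0).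
Proof.
have pow2 p : ((2 : C) ^+ p == 1) = (p == 0%N).
  by rewrite pexprn_eq1 ?ler0n // (eqr_nat _ 2 1) orbF.
case: n => n; first exact: pow2.
by rewrite NegzE -exprnN invr_eq1 pow2.
Qed.

Lemma character0 t : character (fun=> 0) t = 1 :> C.
Proof. by rewrite /character big1 // => k _; rewrite expr0z. Qed.

Lemma weight_point_const (a : 'I_3 -> int) :
  (forall k l, a k = a l) -> weight_point R a = 0.
Proof.
move=> ac.
by rewrite weight_pointE (ac 0 ord_max) (ac 1 ord_max) !subrr !mulr0z addr0.
Qed.

Lemma character_point0 (a : 'I_3 -> int) :
  weight_point R a = 0 -> {in @torus R, forall t, character a t = 1}.
Proof.
move=> a0 t tT; rewrite (@weight_point_inj R a (fun=> 0)) ?character0 //.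
by rewrite a0 weight_point_const.
Qed.

Lemma weight_point_eq0P (a : 'I_3 -> int) :
  weight_point R a = 0 <-> forall k l, a k = a l.
Proof.
split=> [a0 k l|]; last exact: weight_point_const.
have /eqP := character_point0 a0 (cochar_torus k l).
by rewrite character_cochar expz2_eq1 subr_eq0 => /eqP.
Qed.

(** The three exponents add up to 1 - d; if they are all equal to -m, then
    d = 3m + 1 and the monomial is x_l (xyz)^m. *)
Lemma monomial_weight_constP d l i j : (i <= j <= d)%N ->
  (forall k k', monomial_weight l i j d k = monomial_weight l i j d k') ->
  exists m, [/\ d = (3 * m).+1, i = (m + (l == ord_max))%N
              & j = (2 * m + (l != 0%R))%N].
Proof.
case/andP=> le_ij le_jd ac.
have := ac 0 ord_max; have := ac 1 ord_max.
rewrite /monomial_weight !multinomE !(tnth_nth 0%N) /=.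
case: l {ac} => [[|[|[|//]]] lt_l]; rewrite -!(inj_eq val_inj) /= => e1 e0.
- by exists i; split; lia.
- by exists i; split; lia.
- by exists i.-1; split; lia.
Qed.

(** * The weight space at the origin in degree 3m + 1 *)

(** The field x_l (xyz)^m d/dx_l, by [balanced_vfieldE]; it is balanced in
    that its three exponents are equal. *)
Definition balanced_vfield m (l : 'I_3) : vfield R (3 * m).+1 :=
  monomial_vfield R (3 * m).+1 l (m + (l == ord_max)) (2 * m + (l != 0%R)).

Lemma balanced_mnm m (l : 'I_3) :
  monomial_mnm (3 * m).+1 (m + (l == ord_max)) (2 * m + (l != 0%R)) =
  (U_(l) + xyz_mnm m)%MM.
Proof.
case: l => [[|[|[|//]]] lt_l]; apply: mnm3P;
  rewrite mnmDE mnm1E xyz_mnmE multinomE (tnth_nth 0%N) -?(inj_eq val_inj) /=;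
  lia.
Qed.

Lemma balanced_vfieldE m l k :
  val (balanced_vfield m l k) =
  if k == l then 'X_l * 'X_[xyz_mnm m] else 0 :> {mpoly C[3]}.
Proof.
rewrite ffunE; case: eqP => // _; rewrite balanced_mnm val_indhomogX ?mpolyXD //.
by rewrite mdegD mdeg1 mdeg_xyz add1n.
Qed.

Lemma balanced_weight_const m l k k' (a := monomial_weight l
    (m + (l == ord_max)) (2 * m + (l != 0%R)) (3 * m).+1) : a k = a k'.
Proof.
rewrite /a /monomial_weight balanced_mnm !mnmDE !mnm1E !xyz_mnmE.
by rewrite ![_ == l]eq_sym; lia.
Qed.

(** The sum of the three fields is the radial field of (xyz)^m. *)
Lemma sum_balanced_classes m : \sum_l vclass (balanced_vfield m l) = 0.
Proof.
rewrite -linear_sum; apply/eqP; rewrite vclass_eq0.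
apply/memv_imgP; exists (indhomog (3 * m) 'X_[xyz_mnm m]); first exact: memvf.
rewrite lfunE /=; apply/ffunP=> k; apply: val_inj; rewrite sum_ffunE !ffunE.
rewrite raddf_sum /= (bigD1 k) //= balanced_vfieldE eqxx.
rewrite big1 ?addr0 => [|l lk]; last by rewrite balanced_vfieldE eq_sym (negPf lk).
by rewrite val_indhomogX ?mdeg_xyz.
Qed.

(** No combination of the first two fields has a z-component, so a radial one
    vanishes. *)
Lemma balanced_classes_free m :
  free [:: vclass (balanced_vfield m 0); vclass (balanced_vfield m 1)].
Proof.
pose b l : vfield R _ := balanced_vfield m l.
have ind (c0 c1 : C) : c0 *: b 0 + c1 *: b 1 \in radial_space R (3 * m).+1 ->
    c0 = 0 /\ c1 = 0.
  move/(@radial_space_eq0 _ _ ord_max) => X0.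
  have {}X0 : c0 *: b 0 + c1 *: b 1 = 0.
    by apply: X0; apply: val_inj; rewrite !ffunE /= !scaler0 addr0.
  have coef k : c0 *: val (b 0 k) + c1 *: val (b 1 k) = 0.
    by have := congr1 (fun X : vfield R _ => val (X k)) X0; rewrite /= !ffunE.
  have nz (l : 'I_3) : 'X_l * 'X_[xyz_mnm m] != 0 :> {mpoly C[3]}.
    by rewrite -mpolyXD mpolyX_neq0.
  split; [have := coef 0|have := coef 1]; rewrite !balanced_vfieldE /= scaler0.
    by rewrite addr0 => /eqP; rewrite scaler_eq0 (negPf (nz _)) orbF => /eqP.
  by rewrite add0r => /eqP; rewrite scaler_eq0 (negPf (nz _)) orbF => /eqP.
rewrite free_cons seq1_free span_seq1 vclass_eq0; apply/andP; split.
  apply/negP=> /vlineP[c e]; have [] := ind 1 (- c).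
    rewrite -vclass_eq0 linearD !linearZ /= scale1r.
    by rewrite [X in X + _]e scaleNr subrr.
  by move/eqP; rewrite oner_eq0.
apply/negP=> b1; have [|_ /eqP] := ind 0 1; last by rewrite oner_eq0.
by rewrite scale0r add0r scale1r.
Qed.

Definition zero_weight_space m : {vspace W R (3 * m).+1} :=
  <<[:: vclass (balanced_vfield m 0%R); vclass (balanced_vfield m 1%R)]>>%VS.

Lemma balanced_class_mem m l :
  vclass (balanced_vfield m l) \in zero_weight_space m.
Proof.
have memb : (vclass (balanced_vfield m 0) \in zero_weight_space m) /\
            (vclass (balanced_vfield m 1) \in zero_weight_space m).
  by split; rewrite memv_span ?inE ?eqxx ?orbT.
case: l => [[|[|[|//]]] lt_l].
- by rewrite (_ : Ordinal lt_l = 0); [case: memb|apply: val_inj].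
- by rewrite (_ : Ordinal lt_l = 1); [case: memb|apply: val_inj].
have := sum_balanced_classes m; rewrite !big_ord_recr big_ord0 /= add0r.
move/eqP; rewrite addrC addr_eq0 => /eqP e.
rewrite (_ : Ordinal lt_l = ord_max); last exact: val_inj.
rewrite e memvN memvD //; [case: memb => + _|case: memb => _].
  by congr (vclass (balanced_vfield m _) \in _); apply: val_inj.
by congr (vclass (balanced_vfield m _) \in _); apply: val_inj.
Qed.

Lemma torus_fix_zero_weight_space m t (w : W R (3 * m).+1) :
  w \in zero_weight_space m -> torus_act t w = w.
Proof.
have fixb l :
    torus_act t (vclass (balanced_vfield m l)) = vclass (balanced_vfield m l).
  rewrite torus_act_monomial; last by case: l => [[|[|[|]]]] //=; lia.
  rewrite character_point0 ?scale1r ?(valP t) //.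
  exact/weight_point_const/balanced_weight_const.
rewrite /zero_weight_space span_cons span_seq1.
case/memv_addP=> _ /vlineP[c0 ->] [_ /vlineP[c1 ->] ->].
by rewrite linearP linearZ /= !fixb.
Qed.

Lemma zero_weight_spaceP m : is_weight_space (fun=> 0) (zero_weight_space m).
Proof.
pose tor t tT := exist (fun t => t \in @torus R) t tT.
move=> w; split=> [wU t tT|fw].
  by rewrite character0 scale1r; apply: (torus_fix_zero_weight_space (tor t tT)).
apply: (joint_eigenspace_sub (f := @torus_act _) (mu := fun=> 1)
          _ _ (monomial_classes_span w)).
- by move=> t u uU; rewrite scale1r; apply: torus_fix_zero_weight_space.
- move=> v /imageP[[[l i] j] le_ij ->] /=; rewrite inE /= in le_ij.
  have le_ijd : (i <= j <= (3 * m).+1)%N by rewrite le_ij -ltnS ltn_ord.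
  pose a := monomial_weight l i j (3 * m).+1.
  exists (fun t => character a (val t)).
    by move=> t; apply: torus_act_monomial.
  have [/existsP[k /existsP[k' ne]]|] := boolP [exists k, exists k', a k != a k'].
    right; exists (tor _ (cochar_torus k k')).
    by rewrite character_cochar expz2_eq1 subr_eq0.
  rewrite negb_exists => /forallP ac; left.
  have [|n [eq_mn -> ->]] := monomial_weight_constP (l := l) le_ijd.
    move=> k k'; have := ac k; rewrite negb_exists => /forallP/(_ k').
    by rewrite negbK => /eqP.
  have <- : m = n by lia.
  exact: balanced_class_mem.
by move=> t; rewrite -(character0 (val t)); apply/fw/valP.
Qed.

End Foliations.

Theorem theorem3p2 (R : realType) (d : nat) (hd : (1 <= d)%N) :
  double_point d ((0%R, 0%R) : (R * R)%type) <-> exists m : nat, d = (3 * m + 1)%N.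
Proof.
split=> [[[l [i [j [le_ijd eq0]]]] _]|[m ->]].
  move: eq0; rewrite -weight_point_monomial // => /esym/weight_point_eq0P.
  case/(monomial_weight_constP le_ijd) => m [-> _ _].
  by exists m; rewrite addn1.
rewrite addn1; split.
  exists 0, m, (2 * m)%N; have le_m : (m <= 2 * m <= (3 * m).+1)%N by lia.
  split=> //; rewrite -weight_point_monomial //.
  apply/esym/weight_point_const => k k'.
  by have := balanced_weight_const m 0 k k'; rewrite !addn0.
exists (fun=> 0), (zero_weight_space R m); split.
- exact: weight_point_const.
- exact: zero_weight_spaceP.
- by have /eqP := balanced_classes_free R m.
Qed.
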